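(* The category $\mathsf{ContMet}$ is Cartesian closed, where $\mathsf{ContMet}$ is the full subcategory of $\mathsf{App}$ consisting of all injective approach spaces.
   Context: $UX$ is the set of ultrafilters on $X$, $Uf$ the image-ultrafilter map, $e_X(x)$ the principal ultrafilter at $x$, and $m_X\colon UUX\to UX$, $m_X(\mathfrak X)=\{A\subseteq X\mid A^\#\in\mathfrak X\}$ with $A^\#=\{\mathfrak x\in UX\mid A\in\mathfrak x\}$. For $r\colon X\times Y\to[0,\infty]$ one puts $Ur\colon UX\times UY\to[0,\infty]$, $Ur(\mathfrak x,\mathfrak y)=\sup_{A\in\mathfrak x,B\in\mathfrak y}\inf_{x\in A,y\in B}r(x,y)$. An approach space is a pair $(X,a)$ with a function $a\colon UX\times X\to[0,\infty]$ satisfying $a(e_X(x),x)=0$ and $Ua(\mathfrak X,\mathfrak x)+a(\mathfrak x,x)\ge a(m_X(\mathfrak X),x)$ for all $\mathfrak X\in UUX$, $\mathfrak x\in UX$, $x\in X$. A contraction map $f\colon(X,a)\to(Y,b)$ is a function with $a(\mathfrak x,x)\ge b(Uf(\mathfrak x),f(x))$. $\mathsf{App}$ is the category of approach spaces and contraction maps. An embedding is an injective contraction map $i\colon(A,a)\to(B,b)$ with $a(\mathfrak x,x)=b(Ui(\mathfrak x),i(x))$ for all $\mathfrak x,x$. An approach space $X$ is injective if for every embedding $i\colon A\to B$ and every contraction map $f\colon A\to X$ there is a contraction map $g\colon B\to X$ with $g\cdot i=f$. (Spaces are not assumed to be T$_0$.) A metric space is called continuous if it underlies an injective approach space, i.e.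 has metric $a_0(x,y)=a(e_X(x),y)$ for an injective approach space $(X,a)$; this is the reason for the name $\mathsf{ContMet}$. *)

(* Defs.v *)
From mathcomp Require Import all_boot all_order all_algebra.
From mathcomp Require Import boolp classical_sets filter reals ereal.

Set Implicit Arguments.
Unset Strict Implicit.
Unset Printing Implicit Defensive.

Import Order.TTheory GRing.Theory Num.Theory.

Local Open Scope classical_set_scope.
Local Open Scope ereal_scope.

(** * Categories *)

Record category := Category {
  obj :> Type;
  hom : obj -> obj -> Type;
  idm : forall A : obj, hom A A;
  compm : forall A B C : obj, hom B C -> hom A B -> hom A C;
  compmA : forall (A B C D : obj) (h : hom C D) (g : hom B C) (f : hom A B),
    compm h (compm g f) = compm (compm h g) f;
  comp1m : forall (A B : obj) (f : hom A B), compm (idm B) f = f;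
  compm1 : forall (A B : obj) (f : hom A B), compm f (idm A) = f
}.

Arguments hom {c} A B.
Arguments idm {c} A.
Arguments compm {c A B C} g f.

Definition full_subcategory (C : category) (P : C -> Prop) : category :=
  {| obj := {A : C | P A};
     hom := fun A B => hom (sval A) (sval B);
     idm := fun A => idm (sval A);
     compm := fun A B D g f => compm g f;
     compmA := fun A B D E h g f => compmA h g f;
     comp1m := fun A B f => comp1m f;
     compm1 := fun A B f => compm1 f |}.

Record terminal_object (C : category) := TerminalObject {
  term_obj :> C;
  term_map : forall A : C, hom A term_obj;
  term_map_uniq : forall (A : C) (f : hom A term_obj), f = term_map A
}.

Record binary_product (C : category) (A B : C) := BinaryProduct {
  prod_obj :> C;
  prod_fst : hom prod_obj A;
  prod_snd : hom prod_obj B;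
  prod_pair : forall X : C, hom X A -> hom X B -> hom X prod_obj;
  prod_fst_pair : forall (X : C) (f : hom X A) (g : hom X B),
    compm prod_fst (prod_pair f g) = f;
  prod_snd_pair : forall (X : C) (f : hom X A) (g : hom X B),
    compm prod_snd (prod_pair f g) = g;
  prod_pair_uniq : forall (X : C) (h : hom X prod_obj),
    h = prod_pair (compm prod_fst h) (compm prod_snd h)
}.

Definition prod_map (C : category) (A B A' B' : C)
    (P : binary_product A B) (P' : binary_product A' B')
    (f : hom A A') (g : hom B B') : hom (P : C) (P' : C) :=
  prod_pair P' (compm f (prod_fst P)) (compm g (prod_snd P)).

Record exponential (C : category) (prod : forall A B : C, binary_product A B)
    (A B : C) := Exponential {
  exp_obj :> C;
  exp_eval : hom (prod exp_obj A : C) B;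
  exp_curry : forall X : C, hom (prod X A : C) B -> hom X exp_obj;
  exp_curryK : forall (X : C) (f : hom (prod X A : C) B),
    compm exp_eval (prod_map (prod X A) (prod exp_obj A)
                      (exp_curry f) (idm A)) = f;
  exp_curry_uniq : forall (X : C) (g : hom X exp_obj),
    g = exp_curry (compm exp_eval (prod_map (prod X A) (prod exp_obj A)
                                     g (idm A)))
}.

Record cartesian_closed (C : category) := CartesianClosed {
  cc_terminal : terminal_object C;
  cc_product : forall A B : C, binary_product A B;
  cc_exponential : forall A B : C, exponential cc_product A B
}.

(** * The ultrafilter monad *)

Record ultrafilter (X : Type) := Ultrafilter {
  ultra_sets :> set_system X;
  ultra_setsP : UltraFilter ultra_sets
}.

Lemma ultrafilter_ext (X : Type) (u v : ultrafilter X) :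
  (forall A : set X, ultra_sets u A <-> ultra_sets v A) -> u = v.
Proof.
case: u => u Hu; case: v => v Hv /= uv.
have E : u = v by apply/seteqP; split=> A /uv.
by subst v; congr Ultrafilter; exact: Prop_irrelevance.
Qed.

Lemma ultra_dichotomyP (X : Type) (F : set_system X) :
  ProperFilter F -> (forall A : set X, F A \/ F (~` A)) -> UltraFilter F.
Proof.
move=> FF FC; split=> // G GF FG; apply/seteqP; split=> A; last exact: FG.
move=> GA; case: (FC A) => // /FG GnA; exfalso.
by apply: (@filter_not_empty _ G GF); rewrite -(setICr A); exact: filterI.
Qed.

Lemma umap_subproof (X Y : Type) (f : X -> Y) (u : ultrafilter X) :
  UltraFilter (fmap f u).
Proof.
have uP := ultra_setsP u; apply: ultra_dichotomyP => A.
exact: (in_ultra_setVsetC (f @^-1` A) uP).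
Qed.

Definition umap (X Y : Type) (f : X -> Y) (u : ultrafilter X) :
  ultrafilter Y := Ultrafilter (umap_subproof f u).

Definition uprincipal (X : Type) (x : X) : ultrafilter X :=
  Ultrafilter (principal_filter_ultra x).

Definition usharp (X : Type) (A : set X) : set (ultrafilter X) :=
  [set u | ultra_sets u A].

Lemma ujoin_subproof (X : Type) (U : ultrafilter (ultrafilter X)) :
  UltraFilter [set A : set X | ultra_sets U (usharp A)].
Proof.
have UP := ultra_setsP U.
have FU : Filter [set A : set X | ultra_sets U (usharp A)].
  split=> [|A B UA UB|A B AB]; rewrite /mkset.
  - apply: (@filterS _ U) (@filterT _ U _) => u _.
    by have uP := ultra_setsP u; exact: filterT.
  - apply: (@filterS _ U) (@filterI _ U _ _ _ UA UB) => u [uA uB].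
    by have uP := ultra_setsP u; exact: filterI.
  - by apply: (@filterS _ U) => u; have uP := ultra_setsP u; exact: filterS.
apply: ultra_dichotomyP => [|A].
  apply: Build_ProperFilter => U0.
  apply: (@filter_not_empty _ (ultra_sets U)).
  by apply: (@filterS _ U) U0 => u; have uP := ultra_setsP u; exact: filter_not_empty.
case: (in_ultra_setVsetC (usharp A) UP) => UA; [by left | right].
apply: (@filterS _ U) UA => u nuA.
by case: (in_ultra_setVsetC A (ultra_setsP u)).
Qed.

Definition ujoin (X : Type) (U : ultrafilter (ultrafilter X)) :
  ultrafilter X := Ultrafilter (ujoin_subproof U).

(** * Approach spaces

    Values in [0, +oo] are represented as nonnegative elements of [\bar R].
    Suprema and infima computed in [\bar R] agree with those of [0, +oo],
    except for the supremum of the empty set, which does not occur in [urel]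
    since an ultrafilter is a nonempty family. *)

Definition urel (R : realType) (X Y : Type) (r : X -> Y -> \bar R)
    (u : ultrafilter X) (v : ultrafilter Y) : \bar R :=
  ereal_sup [set ereal_inf [set r x y | x in A & y in B]
            | A in ultra_sets u & B in ultra_sets v].

Record approach_space (R : realType) := ApproachSpace {
  app_carrier :> Type;
  app_dist : ultrafilter app_carrier -> app_carrier -> \bar R;
  app_dist_ge0 : forall u x, 0 <= app_dist u x;
  app_dist_refl : forall x, app_dist (uprincipal x) x = 0;
  app_dist_trans : forall (U : ultrafilter (ultrafilter app_carrier))
      (u : ultrafilter app_carrier) (x : app_carrier),
    app_dist (ujoin U) x <= urel app_dist U u + app_dist u x
}.

Record contraction (R : realType) (X Y : approach_space R) := Contraction {
  contr_fun :> X -> Y;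
  contr_le : forall u x,
    app_dist (umap contr_fun u) (contr_fun x) <= app_dist u x
}.

Lemma contraction_ext (R : realType) (X Y : approach_space R)
    (f g : contraction X Y) : contr_fun f =1 contr_fun g -> f = g.
Proof.
case: f => f Hf; case: g => g Hg /= /funext fg; subst g.
by congr Contraction; exact: Prop_irrelevance.
Qed.

Lemma contr_id_subproof (R : realType) (X : approach_space R) u (x : X) :
  app_dist (umap (fun y : X => y) u) x <= app_dist u x.
Proof. by rewrite (_ : umap _ u = u) //; exact: ultrafilter_ext. Qed.

Definition contr_id (R : realType) (X : approach_space R) : contraction X X :=
  Contraction (@contr_id_subproof R X).

Lemma contr_comp_subproof (R : realType) (X Y Z : approach_space R)
    (g : contraction Y Z) (f : contraction X Y) u (x : X) :
  app_dist (umap (fun y : X => g (f y)) u) (g (f x)) <= app_dist u x.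
Proof.
rewrite (_ : umap _ u = umap g (umap f u)); last exact: ultrafilter_ext.
exact: le_trans (contr_le g _ _) (contr_le f _ _).
Qed.

Definition contr_comp (R : realType) (X Y Z : approach_space R)
    (g : contraction Y Z) (f : contraction X Y) : contraction X Z :=
  Contraction (contr_comp_subproof g f).

Definition App (R : realType) : category :=
  {| obj := approach_space R;
     hom := @contraction R;
     idm := @contr_id R;
     compm := @contr_comp R;
     compmA := fun A B C D h g f =>
       contraction_ext (f := contr_comp h (contr_comp g f))
         (g := contr_comp (contr_comp h g) f) (fun=> erefl);
     comp1m := fun A B f =>
       contraction_ext (f := contr_comp (contr_id B) f) (g := f)
         (fun=> erefl);
     compm1 := fun A B f =>
       contraction_ext (f := contr_comp f (contr_id A)) (g := f)
         (fun=> erefl) |}.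

Definition embedding (R : realType) (A B : approach_space R)
    (i : contraction A B) : Prop :=
  injective i /\ forall u x, app_dist u x = app_dist (umap i u) (i x).

Definition injective_space (R : realType) (X : approach_space R) : Prop :=
  forall (A B : approach_space R) (i : contraction A B), embedding i ->
  forall f : contraction A X,
  exists g : contraction B X, contr_comp g i = f.

Definition ContMet (R : realType) : category :=
  full_subcategory (C := App R) (@injective_space R).

(* Main.v *)
(* Products preserve embeddings, so an exponential [Y^X] in App of an injective
   [Y] is again injective; the point is that an injective [X] is exponentiable
   in App.  The exponential carries the least distance making evaluation a
   contraction, and its triangle inequality follows once [X] interpolates: if
   [a(m(U), x) <= s + t] then some ultrafilter [v] satisfies [Ua(U, v) <= s] and
   [a(v, x) <= t].  For injective [X] such a [v] is found by embedding [X] in a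
   space with extra points, one for each set of ultrafilters on [X], where the
   interpolating ultrafilter exists by construction, and retracting. *)

From mathcomp Require Import all_boot all_order all_algebra.
From mathcomp Require Import boolp classical_sets filter reals ereal.
Require Import Defs.

Set Implicit Arguments.
Unset Strict Implicit.
Unset Printing Implicit Defensive.

Import Order.TTheory GRing.Theory Num.Theory.

Local Open Scope classical_set_scope.
Local Open Scope ereal_scope.

#[local] Existing Instance ultra_setsP.

(** * Ultrafilters *)

Lemma ultra_exists_base (I T : Type) (D : set I) (B : I -> set T) :
  D !=set0 ->
  (forall i j, D i -> D j -> exists2 k, D k & B k `<=` B i `&` B j) ->
  (forall i, D i -> B i !=set0) ->
  exists u : ultrafilter T, forall i, D i -> ultra_sets u (B i).
Proof.
move=> D0 BI Bn0.
have FF := filter_from_filter D0 BI.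
have [G [GU sG]] := ultraFilterLemma (filter_from_proper FF Bn0).
exists (Ultrafilter GU) => i Di /=.
by apply: sG; exists i.
Qed.

Lemma ultrafilter_sub_eq (T : Type) (u v : ultrafilter T) :
  ultra_sets u `<=` ultra_sets v -> u = v.
Proof.
move=> uv; apply: ultrafilter_ext => A.
by rewrite (max_filter (ultra_proper (F := v)) uv).
Qed.

Lemma umap_comp (X Y Z : Type) (g : Y -> Z) (f : X -> Y) (u : ultrafilter X) :
  umap g (umap f u) = umap (fun x => g (f x)) u.
Proof. exact: ultrafilter_ext. Qed.

Lemma umap_id (X : Type) (u : ultrafilter X) : umap (fun x => x) u = u.
Proof. exact: ultrafilter_ext. Qed.

Lemma eq_umap (X Y : Type) (f g : X -> Y) (u : ultrafilter X) :
  f =1 g -> umap f u = umap g u.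
Proof. by move=> /funext ->. Qed.

Lemma eq_umap_on (X Y : Type) (f g : X -> Y) (u : ultrafilter X) :
  ultra_sets u [set x | f x = g x] -> umap f u = umap g u.
Proof.
move=> E; apply: ultrafilter_sub_eq => A uA.
by apply: (@filterS _ u) (filterI E uA) => x [/= <-].
Qed.

Lemma umap_principal (X Y : Type) (f : X -> Y) (x : X) :
  umap f (uprincipal x) = uprincipal (f x).
Proof.
by apply: ultrafilter_ext => A /=; split=> /principal_filterP h;
  apply/principal_filterP.
Qed.

Lemma umap_ujoin (X Y : Type) (f : X -> Y) (U : ultrafilter (ultrafilter X)) :
  umap f (ujoin U) = ujoin (umap (umap f) U).
Proof. exact: ultrafilter_ext. Qed.

Lemma umap_lift (X Y : Type) (f : X -> Y) (v : ultrafilter Y) (A : set X) :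
  ultra_sets v (f @` A) ->
  exists2 u : ultrafilter X, ultra_sets u A & umap f u = v.
Proof.
move=> vA.
have [|B C vB vC|B vB|u uB] :=
  @ultra_exists_base _ X (ultra_sets v) (fun B => A `&` f @^-1` B).
- by exists setT; exact: filterT.
- exists (B `&` C); first exact: filterI.
  by move=> x [? []].
- have [y [[x Ax <-] Bx]] := filter_ex (filterI vA vB).
  by exists x.
exists u.
- by apply: (@filterS _ u) (uB _ (filterT : ultra_sets v setT)) => x [].
- apply: esym; apply: ultrafilter_sub_eq => B vB.
  by apply: (@filterS _ u) (uB _ vB) => x [].
Qed.

(** The traces on [r] of the rectangles with sides in [u] and [v] form a filter base; an ultrafilter
    finer than it has marginals containing [u] and [v], hence equal to them by maximality. *)
Lemma ultra_couple (X Y : Type) (u : ultrafilter X) (v : ultrafilter Y)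
    (r : set (X * Y)) :
  (forall A B, ultra_sets u A -> ultra_sets v B ->
    exists x y, [/\ A x, B y & r (x, y)]) ->
  exists w : ultrafilter (X * Y),
    [/\ ultra_sets w r, umap fst w = u & umap snd w = v].
Proof.
move=> H.
have [||[A B] [uA vB]|w wB] := @ultra_exists_base _ (X * Y)%type
  [set AB : set X * set Y | ultra_sets u AB.1 /\ ultra_sets v AB.2]
  (fun AB => r `&` (AB.1 `*` AB.2)).
- by exists (setT, setT); split; exact: filterT.
- move=> [A B] [A' B'] [/= uA vB] [/= uA' vB'].
  exists (A `&` A', B `&` B'); first by split; exact: filterI.
  by move=> [x y] [/= ? [[? ?] [? ?]]].
- by have [x [y [Ax By rxy]]] := H _ _ uA vB; exists (x, y).
have wI A B : ultra_sets u A -> ultra_sets v B ->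
    ultra_sets w (r `&` (A `*` B)).
  by move=> uA vB; exact: (wB (A, B)).
have uT : ultra_sets u setT by exact: filterT.
have vT : ultra_sets v setT by exact: filterT.
exists w; split.
- by apply: (@filterS _ w) (wI _ _ uT vT) => x [].
- apply: esym; apply: ultrafilter_sub_eq => A uA.
  by apply: (@filterS _ w) (wI _ _ uA vT) => x [_ []].
- apply: esym; apply: ultrafilter_sub_eq => B vB.
  by apply: (@filterS _ w) (wI _ _ uT vB) => x [_ []].
Qed.

(** * Limits of extended-real-valued functions along ultrafilters *)

Section Limits.
Variable R : realType.

Lemma lee_real_gt (x y : \bar R) :
  0 <= y -> (forall r : R, y < r%:E -> x <= r%:E) -> x <= y.
Proof.
case: y => [y| |] // y0 H; last by rewrite leey.
apply/lee_addgt0Pr => e e0; rewrite -EFinD; apply: H.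
by rewrite lte_fin ltrDl.
Qed.

(** Passing to strict real upper bounds lets [ulim_lt] and [urel_lt] produce points; the error [e]
    is shared equally between the two summands. *)
Lemma lee_add_gt (x y z : \bar R) :
  0 <= y -> 0 <= z ->
  (forall r t : R, y < r%:E -> z < t%:E -> x <= (r + t)%:E) -> x <= y + z.
Proof.
case: y => [y| |] // y0; case: z => [z| |] // z0 H; try by rewrite leey.
apply/lee_addgt0Pr => e e0.
rewrite -!EFinD [e]splitr addrACA; apply: H; by rewrite lte_fin ltrDl divr_gt0.
Qed.

Lemma urel_lt (X Y : Type) (r : X -> Y -> \bar R) u v t (A : set X)
    (B : set Y) :
  urel r u v < t -> ultra_sets u A -> ultra_sets v B ->
  exists x y, [/\ A x, B y & r x y < t].
Proof.
move=> rt uA vB.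
have /ereal_inf_lt[_ [x Ax [y By <-]] ?] :
    ereal_inf [set r x y | x in A & y in B] < t.
  by apply: le_lt_trans rt; apply: ereal_sup_ubound; exists A => //; exists B.
by exists x, y.
Qed.

Lemma urel_le (X Y : Type) (r : X -> Y -> \bar R) u v t :
  (forall A B, ultra_sets u A -> ultra_sets v B ->
    exists x y, [/\ A x, B y & r x y <= t]) ->
  urel r u v <= t.
Proof.
move=> H; apply: ge_ereal_sup => _ [A uA [B vB <-]].
have [x [y [Ax By xyt]]] := H _ _ uA vB.
by apply: ge_ereal_inf; exists (r x y) => //; exists x => //; exists y.
Qed.

Lemma urel_ge0 (X Y : Type) (r : X -> Y -> \bar R) u v :
  (forall x y, 0 <= r x y) -> 0 <= urel r u v.
Proof.
move=> r0; apply: le_ereal_sup_tmp.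
exists (ereal_inf [set r x y | x in setT & y in setT]).
  by exists setT; [exact: filterT|exists setT; [exact: filterT|]].
by apply: le_ereal_inf_tmp => _ [x _ [y _ <-]].
Qed.

Lemma urel_umap (X Y X' Y' : Type) (r : X -> Y -> \bar R)
    (r' : X' -> Y' -> \bar R) (f : X -> X') (g : Y -> Y') u v :
  (forall x y, 0 <= r x y) ->
  (forall x y, r' (f x) (g y) <= r x y) ->
  urel r' (umap f u) (umap g v) <= urel r u v.
Proof.
move=> r0 H; apply: lee_real_gt; first exact: urel_ge0.
move=> t /urel_lt rt; apply: urel_le => A B uA vB.
have [x [y [? ? xyt]]] := rt _ _ uA vB.
by exists (f x), (g y); split=> //; apply: le_trans (H _ _) (ltW xyt).
Qed.

(** A limit inferior; along an ultrafilter it is the limit in the compact space of extended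
    reals. *)
Definition ulim (X : Type) (f : X -> \bar R) (u : ultrafilter X) : \bar R :=
  ereal_sup [set ereal_inf (f @` A) | A in ultra_sets u].

Lemma ulim_ge (X : Type) (f : X -> \bar R) (u : ultrafilter X) A t :
  ultra_sets u A -> (forall x, A x -> t <= f x) -> t <= ulim f u.
Proof.
move=> uA H; apply: le_ereal_sup_tmp.
exists (ereal_inf (f @` A)); first by exists A.
by apply: le_ereal_inf_tmp => _ [x Ax <-]; exact: H.
Qed.

Lemma ulim_le (X : Type) (f : X -> \bar R) (u : ultrafilter X) t :
  (forall A, ultra_sets u A -> exists2 x, A x & f x <= t) -> ulim f u <= t.
Proof.
move=> H; apply: ge_ereal_sup => _ [A uA <-].
have [x Ax xt] := H _ uA.
by apply: ge_ereal_inf; exists (f x) => //; exists x.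
Qed.

(** Here the limit inferior acts as a limit: if the sublevel set is not in [u], its complement is,
    and this bounds the limit from below by [t]. *)
Lemma ulim_lt (X : Type) (f : X -> \bar R) (u : ultrafilter X) t :
  ulim f u < t -> ultra_sets u [set x | f x < t].
Proof.
move=> ut; have [//|uC] := in_ultra_setVsetC [set x | f x < t] (ultra_setsP u).
move: ut; rewrite ltNge => /negP[].
by apply: (ulim_ge uC) => x /negP; rewrite -leNgt.
Qed.

Lemma ulim_ge0 (X : Type) (f : X -> \bar R) (u : ultrafilter X) :
  (forall x, 0 <= f x) -> 0 <= ulim f u.
Proof. by move=> f0; apply: (ulim_ge (A := setT)) => //; exact: filterT. Qed.

Lemma ulim_umap (X Y : Type) (g : X -> Y) (f : Y -> \bar R)
    (u : ultrafilter X) :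
  ulim f (umap g u) = ulim (fun x => f (g x)) u.
Proof.
apply/eqP; rewrite eq_le; apply/andP; split.
- apply: ge_ereal_sup => _ [A uA <-].
  apply: (ulim_ge (A := g @^-1` A) uA) => x Ax.
  by apply: ereal_inf_lbound; exists (g x).
- apply: ge_ereal_sup => _ [A uA <-].
  apply: (@ulim_ge _ _ _ (g @` A)).
    by apply: (@filterS _ u) uA => x Ax; exists x.
  by move=> _ [x Ax <-]; apply: ereal_inf_lbound; exists x.
Qed.

Lemma ulim_principal (X : Type) (f : X -> \bar R) (x : X) :
  ulim f (uprincipal x) = f x.
Proof.
apply/eqP; rewrite eq_le; apply/andP; split.
- by apply: ulim_le => A /principal_filterP Ax; exists x.
- apply: (@ulim_ge _ _ _ [set x]) => [|_ -> //].
  exact/principal_filterP.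
Qed.

(** * Initial approach structures *)

Section Initial.
Variables (X I : Type) (f : I -> X -> \bar R).
Hypothesis f_ge0 : forall i x, 0 <= f i x.

(** The initial approach structure for the maps [f i] into [0, +oo], whose distance is the truncated
    difference of a point and a limit. The maximum with 0 also covers an empty [I]. *)
Definition init_dist (u : ultrafilter X) (x : X) : \bar R :=
  maxe 0 (ereal_sup [set f i x - ulim (f i) u | i in setT]).

Lemma init_dist_leP u x t :
  0 <= t ->
  init_dist u x <= t <-> forall i, f i x <= ulim (f i) u + t.
Proof.
move=> t0; have E i : (f i x - ulim (f i) u <= t) = (f i x <= ulim (f i) u + t).
  have := ulim_ge0 u (f_ge0 i).
  case: (ulim (f i) u) => [r| |] // _; first by rewrite leeBlDl.
  (* The limit is +oo here: the sum is +oo since [t] is not -oo, while the difference is -oo even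
     when [f i x] is +oo, as -oo absorbs in sums. *)
  rewrite addye ?leey; last by rewrite gt_eqF // (lt_le_trans _ t0) // ltNy0.
  by rewrite addeNy (le_trans _ t0) // leNye.
rewrite /init_dist ge_max t0 /=; split=> [H i|H].
- by rewrite -E (le_trans _ H) //; apply: ereal_sup_ubound; exists i.
- by apply: ge_ereal_sup => _ [i _ <-]; rewrite E.
Qed.

Lemma init_dist_ge0 u x : 0 <= init_dist u x.
Proof. by rewrite /init_dist le_max lexx. Qed.

Lemma init_dist_refl x : init_dist (uprincipal x) x = 0.
Proof.
apply/eqP; rewrite eq_le init_dist_ge0 andbT.
by apply/init_dist_leP => // i; rewrite ulim_principal adde0.
Qed.

(** Each [f i] is treated separately. If its limit along [ujoin U] is below [r], then
    [ulim (f i) v <= r] for [U]-many [v], and a point [y] at distance below [t] from such a [v] has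
    [f i y <= r + t]. *)
Lemma init_dist_trans U u x :
  init_dist (ujoin U) x <= urel init_dist U u + init_dist u x.
Proof.
have ur0 : 0 <= urel init_dist U u by apply: urel_ge0; exact: init_dist_ge0.
apply/init_dist_leP; first by rewrite adde_ge0 // init_dist_ge0.
move=> i.
have /(init_dist_leP u x (init_dist_ge0 u x)) -/(_ i) := lexx (init_dist u x).
move=> /le_trans; apply; rewrite addeA; apply: leeD => //.
apply: lee_add_gt => // [|r t]; first exact: ulim_ge0.
move=> /ulim_lt Ur ut; apply: ulim_le => A uA.
have [v [y [/= vr Ay /ltW vyt]]] := urel_lt ut Ur uA.
exists y => //.
have t0 : 0 <= t%:E := le_trans (init_dist_ge0 v y) vyt.
move: vyt => /(init_dist_leP v y t0) -/(_ i) /le_trans; apply.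
rewrite EFinD; apply: leeD => //; apply: ulim_le => B vB.
by have [z [? /ltW ?]] := filter_ex (filterI vB vr); exists z.
Qed.

Definition initial_space : approach_space R :=
  ApproachSpace init_dist_ge0 init_dist_refl init_dist_trans.

End Initial.
End Limits.

(** * Distances to sets, and interpolation in injective spaces *)

Section SetDistance.
Variables (R : realType) (X : approach_space R).
Implicit Types (A : set X) (u v : ultrafilter X) (x : X).

(** The point-to-set distance of the classical axioms for approach spaces. *)
Definition set_dist A x : \bar R :=
  ereal_inf [set app_dist u x | u in usharp A].

Lemma set_dist_ge0 A x : 0 <= set_dist A x.
Proof. by apply: le_ereal_inf_tmp => _ [u _ <-]; exact: app_dist_ge0. Qed.

Lemma set_dist_le A u x : ultra_sets u A -> set_dist A x <= app_dist u x.
Proof. by move=> uA; apply: ereal_inf_lbound; exists u. Qed.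

Lemma set_dist_mem A x : A x -> set_dist A x = 0.
Proof.
move=> Ax; apply/eqP; rewrite eq_le set_dist_ge0 andbT -(app_dist_refl x).
by apply: set_dist_le; apply/principal_filterP.
Qed.

(** Choose for each [y] with [set_dist A y < r] an ultrafilter [g y] containing [A] within [r] of
    [y]. The join of the image of [u] under [g] contains [A], and the triangle inequality through
    [u] bounds its distance to [x]. *)
Lemma set_dist_ulim A u x :
  set_dist A x <= ulim (set_dist A) u + app_dist u x.
Proof.
apply: lee_add_gt; rewrite ?app_dist_ge0 ?ulim_ge0 //.
  exact: set_dist_ge0.
move=> r t /ulim_lt ur /ltW uxt.
have [y|g gP] := @choice _ _ (fun y (v : ultrafilter X) =>
    set_dist A y < r%:E -> ultra_sets v A /\ app_dist v y < r%:E).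
  have [/ereal_inf_lt[_ [w wA <-] wr]|] := pselect (set_dist A y < r%:E).
    by exists w.
  by exists (uprincipal y).
have UA : ultra_sets (ujoin (umap g u)) A.
  by apply: (@filterS _ u) ur => y /gP[].
apply: le_trans (set_dist_le x UA) _.
apply: le_trans (app_dist_trans _ u _) _.
rewrite EFinD; apply: leeD => //; apply: urel_le => B C uB uC.
have {}uB : ultra_sets u (g @^-1` B) := uB.
have [y [[By Cy] /gP[_ /ltW ?]]] := filter_ex (filterI (filterI uB uC) ur).
by exists (g y), y.
Qed.

(** For [r > t], each [A] in [u] belongs to some ultrafilter within [r] of [x]. These ultrafilters
    are collected into a [U] with join [u], and the triangle inequality is applied through the
    principal ultrafilter at [x]. *)
Lemma app_dist_le_set_dist u x t :
  0 <= t -> (forall A, ultra_sets u A -> set_dist A x <= t) ->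
  app_dist u x <= t.
Proof.
move=> t0 H; apply: lee_real_gt => // r tr.
have [|A B uA uB|A uA|U UP] := @ultra_exists_base _ _ (ultra_sets u)
  (fun A => usharp A `&` [set v | app_dist v x < r%:E]).
- by exists setT; exact: filterT.
- exists (A `&` B); first exact: filterI.
  by move=> v [vAB ?]; split; split => //; apply: (@filterS _ v) vAB => y [].
- by have /ereal_inf_lt[_ [v vA <-] ?] := le_lt_trans (H _ uA) tr; exists v.
have -> : u = ujoin U.
  by apply: ultrafilter_sub_eq => A /UP; apply: (@filterS _ U) => v [].
apply: le_trans (app_dist_trans _ (uprincipal x) _) _.
rewrite app_dist_refl adde0; apply: urel_le => A B UA /principal_filterP Bx.
have [v [Av [_ /ltW ?]]] := filter_ex (filterI UA (UP _ filterT)).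
by exists v, x.
Qed.

(** So every approach space carries the initial structure for its functions [set_dist A]. For the
    converse, [set_dist A] vanishes on [A], hence has limit at most 0 along any [u] containing
    [A]. *)
Lemma app_dist_leP u x t :
  0 <= t ->
  app_dist u x <= t <->
  forall A, set_dist A x <= ulim (set_dist A) u + t.
Proof.
move=> t0; split=> [uxt A|H].
  by apply: le_trans (set_dist_ulim A u x) _; exact: leeD.
apply: app_dist_le_set_dist => // A uA.
apply: le_trans (H A) _; rewrite -[leRHS]add0e leeD //.
apply: ulim_le => B uB; have [y [Ay By]] := filter_ex (filterI uA uB).
by exists y; rewrite ?set_dist_mem.
Qed.

End SetDistance.

(** * Adjoining points to a space, and interpolating ultrafilters *)

Section Interpolation.
Variables (R : realType) (X : approach_space R) (s : R).
Hypothesis s_ge0 : (0 <= s)%R.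

(* [inr UU] is placed so that every ultrafilter in [UU] is at distance at most
   [s] from it. *)
Definition adjoined_dist (A : set X) (z : X + set (ultrafilter X)) : \bar R :=
  match z with
  | inl x => set_dist A x
  | inr UU => ereal_inf (ulim (set_dist A) @` UU) + s%:E
  end.

Lemma adjoined_dist_ge0 A z : 0 <= adjoined_dist A z.
Proof.
case: z => [x|UU] /=; first exact: set_dist_ge0.
rewrite adde_ge0 ?lee_fin //; apply: le_ereal_inf_tmp => _ [u _ <-].
by apply: ulim_ge0 => x; exact: set_dist_ge0.
Qed.

Definition adjoined_space : approach_space R := initial_space adjoined_dist_ge0.

(** Both structures are initial, and [adjoined_dist A] restricts to [set_dist A] on [X]. *)
Lemma adjoined_inl (u : ultrafilter X) (x : X) :
  app_dist (umap (inl : X -> adjoined_space) u) (inl x : adjoined_space) =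
  app_dist u x.
Proof.
apply/eqP; rewrite eq_le; apply/andP; split.
- apply/(init_dist_leP adjoined_dist_ge0) => [|A]; first exact: app_dist_ge0.
  by rewrite ulim_umap; exact: set_dist_ulim.
- apply/app_dist_leP => [|A]; first exact: app_dist_ge0.
  have H := lexx (app_dist (umap (inl : X -> adjoined_space) u) (inl x)).
  move/(init_dist_leP adjoined_dist_ge0 _ _ (app_dist_ge0 _ _)): H => /(_ A).
  by rewrite ulim_umap.
Qed.

Definition adjoined_inc : contraction X adjoined_space.
Proof.
by exists (inl : X -> adjoined_space) => u x; rewrite adjoined_inl.
Defined.

Lemma adjoined_inc_embedding : embedding adjoined_inc.
Proof. by split=> [x y []//|u x]; rewrite [RHS]adjoined_inl. Qed.

Lemma adjoined_dist_inr (UU : set (ultrafilter X)) (u : ultrafilter X) :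
  UU u ->
  app_dist (umap adjoined_inc u) (inr UU : adjoined_space) <= s%:E.
Proof.
move=> UUu; apply/(init_dist_leP adjoined_dist_ge0); first by rewrite lee_fin.
move=> A; rewrite ulim_umap /= leeD2r //.
by apply: ereal_inf_lbound; exists u.
Qed.

End Interpolation.

(* [v] is the image, under a retraction, of an ultrafilter of adjoined points
   [inr UU] with [UU] shrinking along [U]. *)
Lemma injective_interpolation (R : realType) (X : approach_space R)
    (U : ultrafilter (ultrafilter X)) (x : X) (s : R) (t : \bar R) :
  injective_space X -> (0 <= s)%R -> 0 <= t ->
  app_dist (ujoin U) x <= s%:E + t ->
  exists v : ultrafilter X,
    (forall UU A, ultra_sets U UU -> ultra_sets v A ->
      exists u y, [/\ UU u, A y & app_dist u y <= s%:E]) /\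
    app_dist v x <= t.
Proof.
move=> injX s0 t0 Uxst.
have [g gK] := injX _ _ _ (adjoined_inc_embedding X s0) (contr_id X).
have {}gK y : g (inl y) = y by exact: (congr1 (fun h => contr_fun h y) gK).
have [|UU VV UUU UVV|UU UUU|w wP] := @ultra_exists_base _ _ (ultra_sets U)
  (fun UU => [set VV | VV `<=` UU /\ ultra_sets U VV]).
- by exists setT; exact: filterT.
- exists (UU `&` VV); first exact: filterI.
  by move=> WW [sub ?]; split; split=> // u /sub[].
- by exists UU; split.
exists (umap g (umap inr w)); split=> [UU A UUU wA|].
(* Any [u] in [VV] is within [s] of [inr VV]; since [g] is a contraction fixing [X], it is within
   [s] of [g (inr VV)]. *)
- have [VV [/= gA [sub UVV]]] := filter_ex (@filterI _ w _ _ _ wA (wP _ UUU)).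
  have [u VVu] := filter_ex UVV.
  exists u, (g (inr VV)); split=> //; first exact: sub.
  apply: le_trans (adjoined_dist_inr s0 VVu).
  have := contr_le g (umap (adjoined_inc X s0) u) (inr VV).
  by rewrite umap_comp (eq_umap (g := id) u gK) umap_id.
- rewrite -{1}(gK x); apply: le_trans (contr_le g _ _) _.
  apply/(init_dist_leP (adjoined_dist_ge0 s0)) => // A; rewrite ulim_umap /=.
  apply: le_trans (set_dist_ulim A (ujoin U) x) _.
  apply: le_trans (leeD (le_refl _) Uxst) _; rewrite addeA leeD2r //.
  (* For [B] in [ujoin U], [w]-many [VV] consist of ultrafilters containing [B], whose limits are at
     least the infimum over [B]. The [s] of [Uxst] is matched by the one in [adjoined_dist]. *)
  rewrite -leeBrDr //; apply: ge_ereal_sup => _ [B UB <-]; rewrite leeBrDr //.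
  apply: (ulim_ge (wP _ UB)) => VV [sub _]; rewrite leeD2r //.
  apply: le_ereal_inf_tmp => _ [u /sub uB <-].
  apply: (ulim_ge uB) => y By.
  by apply: ereal_inf_lbound; exists y.
Qed.

(** * Products *)

Section Product.
Variables (R : realType) (X Y : approach_space R).

Definition product_dist (u : ultrafilter (X * Y)) (z : X * Y) : \bar R :=
  maxe (app_dist (umap fst u) z.1) (app_dist (umap snd u) z.2).

Lemma product_dist_ge0 u z : 0 <= product_dist u z.
Proof. by rewrite le_max app_dist_ge0. Qed.

Lemma product_dist_refl z : product_dist (uprincipal z) z = 0.
Proof. by rewrite /product_dist !umap_principal !app_dist_refl maxxx. Qed.

Lemma product_dist_trans U u z :
  product_dist (ujoin U) z <= urel product_dist U u + product_dist u z.
Proof.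
rewrite {1}/product_dist ge_max; apply/andP; split.
- rewrite umap_ujoin; apply: le_trans (app_dist_trans _ (umap fst u) _) _.
  apply: leeD; last by rewrite le_max lexx.
  by apply: urel_umap => *; rewrite ?product_dist_ge0 // le_max lexx.
- rewrite umap_ujoin; apply: le_trans (app_dist_trans _ (umap snd u) _) _.
  apply: leeD; last by rewrite le_max lexx orbT.
  by apply: urel_umap => *; rewrite ?product_dist_ge0 // le_max lexx orbT.
Qed.

Definition product_space : approach_space R :=
  ApproachSpace product_dist_ge0 product_dist_refl product_dist_trans.

Definition product_fst : contraction product_space X.
Proof.
by exists (fst : product_space -> X) => u z; rewrite le_max lexx.
Defined.

Definition product_snd : contraction product_space Y.
Proof.
by exists (snd : product_space -> Y) => u z; rewrite le_max lexx orbT.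
Defined.

Definition product_pair (Z : approach_space R) (f : contraction Z X)
  (g : contraction Z Y) : contraction Z product_space.
Proof.
exists (fun z => (f z, g z) : product_space) => u z.
rewrite /= /product_dist !umap_comp ge_max.
by apply/andP; split; exact: contr_le.
Defined.

End Product.

Lemma product_injective (R : realType) (X Y : approach_space R) :
  injective_space X -> injective_space Y -> injective_space (product_space X Y).
Proof.
move=> injX injY A B i iE f.
have [g gE] := injX _ _ _ iE (contr_comp (product_fst X Y) f).
have [h hE] := injY _ _ _ iE (contr_comp (product_snd X Y) f).
exists (product_pair g h); apply: contraction_ext => a /=.
have /= -> := congr1 (fun k => contr_fun k a) gE.
have /= -> := congr1 (fun k => contr_fun k a) hE.
by rewrite -surjective_pairing.
Qed.

(** * Exponentials *)

Section Exponential.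
Variables (R : realType) (X Y : approach_space R).

Definition ev (z : contraction X Y * X) : Y := z.1 z.2.

(* [expo_dist p h] is the least [t] such that
   [app_dist (umap ev q) (h x) <= maxe t (app_dist (umap snd q) x)] for all [x]
   and all [q] whose first projection is [p]. *)
Definition expo_dist (p : ultrafilter (contraction X Y)) (h : contraction X Y) :
    \bar R :=
  maxe 0 (ereal_sup [set t | exists q x, [/\ umap fst q = p,
    app_dist (umap snd q) x < app_dist (umap ev q) (h x) &
    t = app_dist (umap ev q) (h x)]]).

Lemma expo_dist_ge0 p h : 0 <= expo_dist p h.
Proof. by rewrite le_max lexx. Qed.

Lemma expo_dist_leP p h t :
  0 <= t ->
  expo_dist p h <= t <-> forall q x, umap fst q = p ->
    app_dist (umap ev q) (h x) <= maxe t (app_dist (umap snd q) x).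
Proof.
move=> t0; rewrite /expo_dist ge_max t0 /=; split=> [H q x qp|H].
- rewrite le_max; case: (leP _ (app_dist (umap snd q) x)) => [|lt].
    by rewrite orbT.
  by rewrite (le_trans _ H) //; apply: ereal_sup_ubound; exists q, x.
- apply: ge_ereal_sup => _ [q [x [qp lt ->]]].
  by have := H q x qp; rewrite le_max => /orP[//|]; rewrite leNgt lt.
Qed.

Lemma ev_le q (h : contraction X Y) x :
  app_dist (umap ev q) (h x) <=
  maxe (expo_dist (umap fst q) h) (app_dist (umap snd q) x).
Proof.
have := lexx (expo_dist (umap fst q) h).
by move/(expo_dist_leP _ _ (expo_dist_ge0 _ _)) => ->.
Qed.

(** An ultrafilter [q] lying over the principal one at [h] is concentrated on pairs [(h, y)], where
    [ev] agrees with [h] after [snd]. *)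
Lemma expo_dist_refl h : expo_dist (uprincipal h) h = 0.
Proof.
apply/eqP; rewrite eq_le expo_dist_ge0 andbT.
apply/expo_dist_leP => // q x qh; rewrite le_max; apply/orP; right.
have -> : umap ev q = umap h (umap snd q); last exact: contr_le.
rewrite umap_comp; apply: eq_umap_on.
have {}qh : ultra_sets q (fst @^-1` [set h]).
  have : ultra_sets (umap fst q) [set h] by rewrite qh; exact/principal_filterP.
  by [].
by apply: (@filterS _ q) qh => -[k y] /= ->.
Qed.

Hypothesis injX : injective_space X.

(* With [M] the right-hand side and [x] at distance at most [M = s + (M - s)]
   from [umap snd q], interpolation in [X] yields points at distance at most
   [s] converging to [x] up to [M - s >= t]; evaluating along [U] and [u] at
   these points splits the bound [M] in [Y] additively. *)
Lemma expo_dist_trans_ev (U : ultrafilter (ultrafilter (contraction X Y)))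
    (u : ultrafilter (contraction X Y)) (h : contraction X Y) (s t : R) q x :
  urel expo_dist U u < s%:E -> expo_dist u h <= t%:E ->
  umap fst q = ujoin U ->
  app_dist (umap ev q) (h x) <= maxe (s + t)%:E (app_dist (umap snd q) x).
Proof.
move=> Us ut qU.
have s0 : (0 <= s)%R.
  rewrite -lee_fin (le_trans _ (ltW Us)) // urel_ge0 //.
  exact: expo_dist_ge0.
have t0 : 0 <= t%:E := le_trans (expo_dist_ge0 u h) ut.
case aE : (app_dist (umap snd q) x) => [a| |]; last 2 first.
- by rewrite le_max leey orbT.
- by have := app_dist_ge0 (umap snd q) x; rewrite aE.
rewrite -EFin_max; set M := Order.max _ _.
have tM : t%:E <= (M - s)%:E by rewrite lee_fin lerBrDl le_max lexx.
(* [J] consists of pairs [(r, k)] whose functions are within [s], with the [r] joining to [q] and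
   the [k] forming [u]. The bound [Us] supplies an ultrafilter of functions near [k], which
   [umap_lift] lifts to [r]. *)
have [||[Q T] [/= qQ uT]|J JP] := @ultra_exists_base _
    (ultrafilter (contraction X Y * X) * contraction X Y)%type
    [set QT : set (contraction X Y * X) * set (contraction X Y) |
      ultra_sets q QT.1 /\ ultra_sets u QT.2]
    (fun QT => (usharp QT.1 `*` QT.2) `&`
      [set rh | expo_dist (umap fst rh.1) rh.2 <= s%:E]).
- by exists (setT, setT); split; exact: filterT.
- move=> [Q T] [Q' T'] [/= qQ uT] [/= qQ' uT'].
  exists (Q `&` Q', T `&` T'); first by split; exact: filterI.
  by move=> [r k] [[/= rQ [? ?]] ?]; split; split=> //; split=> //;
    apply: (@filterS _ r) rQ => y [].
- have UQ : ultra_sets (ujoin U) (fst @` Q).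
    by rewrite -qU; apply: (@filterS _ q) qQ => y Qy; exists y.
  have [p [k [pQ Tk /ltW pk]]] := urel_lt Us UQ uT.
  have [r rQ rp] := umap_lift pQ.
  by exists (r, k); split; rewrite /= ?rp.
have JI Q T : ultra_sets q Q -> ultra_sets u T -> ultra_sets J
    ((usharp Q `*` T) `&` [set rh | expo_dist (umap fst rh.1) rh.2 <= s%:E]).
  by move=> qQ uT; exact: (JP (Q, T)).
have qT : ultra_sets q setT by exact: filterT.
have uT : ultra_sets u setT by exact: filterT.
have Js : ultra_sets J [set rh | expo_dist (umap fst rh.1) rh.2 <= s%:E].
  by apply: (@filterS _ J) (JI _ _ qT uT) => rk [].
have Jq : ujoin (umap fst J) = q.
  apply: esym; apply: ultrafilter_sub_eq => Q qQ.
  by apply: (@filterS _ J) (JI _ _ qQ uT) => -[r k] [[]].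
have Ju : umap snd J = u.
  apply: esym; apply: ultrafilter_sub_eq => T uT'.
  by apply: (@filterS _ J) (JI _ _ qT uT') => -[r k] [[]].
have [||v [Jv vx]] := @injective_interpolation R X
    (umap (umap snd) (umap fst J)) x s (M - s)%:E injX s0.
- exact: le_trans t0 tM.
- by rewrite -umap_ujoin Jq aE -EFinD addrC subrK lee_fin le_max lexx orbT.
pose r : set ((ultrafilter (contraction X Y * X) * contraction X Y) * X) :=
  [set jy | expo_dist (umap fst jy.1.1) jy.1.2 <= s%:E /\
            app_dist (umap snd jy.1.1) jy.2 <= s%:E].
(* [w] attaches to each [(r, k)] a point [y] distributed as [v], within [s] of the second projection
   of [r]. *)
have [A B JA vB|w [wr wJ wv]] := @ultra_couple _ _ J v r.
  have [|_ [y [[j [Aj js] <-] By yv]]] := Jv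
      ((fun j => umap snd j.1) @` (A `&`
        [set rh | expo_dist (umap fst rh.1) rh.2 <= s%:E])) B _ vB.
    rewrite umap_comp.
    by apply: (@filterS _ J) (@filterI _ J _ _ _ JA Js) => j jA; exists j.
  by exists j, y.
have -> : umap ev q =
    ujoin (umap (fun jy => umap ev jy.1.1) w).
  by rewrite -Jq -wJ umap_ujoin !umap_comp.
pose evJ (jy : (ultrafilter (contraction X Y * X) * contraction X Y) * X) : Y :=
  jy.1.2 jy.2.
(* The values [k y] are the intermediate ultrafilter in [Y]: each is within [s] of [umap ev r], and
   they are within the maximum of [t] and [M - s], which is [M - s], of [h x]. *)
apply: le_trans (app_dist_trans _ (umap evJ w) _) _.
have -> : M%:E = s%:E + (M - s)%:E by rewrite -EFinD addrC subrK.
apply: leeD.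
- apply: urel_le => A B wA wB.
  have [jy [[? ?] [js ys]]] := filter_ex
    (@filterI _ w _ _ _ (@filterI _ w _ _ _ wA wB) wr).
  exists (umap ev jy.1.1), (evJ jy); split=> //.
  by apply: le_trans (ev_le _ _ _) _; rewrite ge_max js.
- have -> : umap evJ w =
    umap ev (umap (fun jy => (jy.1.2, jy.2)) w) by rewrite umap_comp.
  apply: le_trans (ev_le _ _ _) _; rewrite !umap_comp /=.
  rewrite -(umap_comp snd fst) wJ Ju wv ge_max vx andbT.
  exact: le_trans ut tM.
Qed.

Lemma expo_dist_trans U u h :
  expo_dist (ujoin U) h <= urel expo_dist U u + expo_dist u h.
Proof.
apply: lee_add_gt; rewrite ?urel_ge0 ?expo_dist_ge0 //.
  exact: expo_dist_ge0.
move=> s t Us /ltW ut; apply/expo_dist_leP => [|q x].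
  rewrite EFinD adde_ge0 ?(le_trans _ ut) ?expo_dist_ge0 //.
  by rewrite (le_trans _ (ltW Us)) // urel_ge0 //; exact: expo_dist_ge0.
exact: expo_dist_trans_ev Us ut.
Qed.

Definition expo_space : approach_space R :=
  ApproachSpace expo_dist_ge0 expo_dist_refl expo_dist_trans.

Definition expo_ev : contraction (product_space expo_space X) Y.
Proof.
by exists (ev : product_space expo_space X -> Y) => q [h x]; exact: ev_le.
Defined.

(** * Transposition of contractions *)

Section Curry.
Variables (W : approach_space R) (f : contraction (product_space W X) Y).

Definition curry_at (w : W) : contraction X Y.
Proof.
exists (fun x => f (w, x)) => u x.
rewrite -(umap_comp f (fun y => (w, y))).
apply: le_trans (contr_le f _ _) _.
rewrite /= /product_dist !umap_comp /= umap_id ge_max lexx andbT.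
(* The first coordinate is constant, so it contributes distance 0. *)
rewrite (_ : umap _ u = uprincipal w) ?app_dist_refl ?app_dist_ge0 //.
apply: esym; apply: ultrafilter_sub_eq => A /principal_filterP Aw.
by apply: (@filterS _ u) (filterT : ultra_sets u setT).
Defined.

(** An ultrafilter [q] over the image of [u] has lost the points of [W]. Coupling [q] with [u] along
    [k = curry_at z] restores them, and evaluation becomes [f]. *)
Definition expo_curry : contraction W expo_space.
Proof.
exists (curry_at : W -> expo_space) => u w.
apply/expo_dist_leP => [|q x qu]; first exact: app_dist_ge0.
have [A B qA uB|v [vE vq vu]] := @ultra_couple _ _ q u
    [set z | z.1.1 = curry_at z.2].
  have : ultra_sets (umap curry_at u) (fst @` A).
    by rewrite -qu; apply: (@filterS _ q) qA => z Az; exists z.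
  move=> uA; have [y [[z Az zy] By]] := filter_ex (@filterI _ u _ _ _ uA uB).
  by exists z, y.
have -> : umap ev q = umap f (umap (fun z => (z.2, z.1.2)) v).
  rewrite -vq !umap_comp; apply: eq_umap_on.
  by apply: (@filterS _ v) vE => -[[k y] z] /= ->.
apply: le_trans (contr_le f _ (w, x)) _.
by rewrite /= /product_dist !umap_comp /= vu -vq umap_comp.
Defined.

End Curry.

End Exponential.

Lemma product_embedding (R : realType) (A B X : approach_space R)
    (i : contraction A B) :
  embedding i ->
  embedding (product_pair (contr_comp i (product_fst A X)) (product_snd A X)).
Proof.
move=> [i_inj iE]; split=> [[a x] [b y] [/i_inj -> ->] //|u [a x]].
by rewrite /= /product_dist !umap_comp /= -(umap_comp i fst) -iE.
Qed.

(** The transpose of [f] is extended along the product of [i] with [X], using injectivity of [Y],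
    and the extension is transposed back. *)
Lemma expo_injective (R : realType) (X Y : approach_space R)
    (injX : injective_space X) :
  injective_space Y -> injective_space (expo_space Y injX).
Proof.
move=> injY A B i iE f.
have [g gE] := injY _ _ _ (product_embedding X iE)
  (contr_comp (expo_ev Y injX)
    (product_pair (contr_comp f (product_fst A X)) (product_snd A X))).
exists (expo_curry injX g); apply: contraction_ext => a.
apply: contraction_ext => x.
exact: (congr1 (fun k => contr_fun k ((a, x) : product_space A X)) gE).
Qed.

(** * Cartesian closedness *)

Section Terminal.
Variable R : realType.

Lemma unit_dist_trans (U : ultrafilter (ultrafilter unit))
    (u : ultrafilter unit) (x : unit) :
  (0 : \bar R) <= urel (fun _ _ => 0) U u + 0.
Proof. by rewrite adde0 urel_ge0. Qed.

Definition unit_space : approach_space R :=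
  @ApproachSpace R unit (fun _ _ => 0) (fun _ _ => lexx 0) (fun=> erefl)
    unit_dist_trans.

Definition unit_map (X : approach_space R) : contraction X unit_space.
Proof. by exists (fun=> tt : unit_space) => u x; exact: app_dist_ge0. Defined.

Lemma unit_map_uniq (X : approach_space R) (f : contraction X unit_space) :
  f = unit_map X.
Proof. by apply: contraction_ext => x; case: (f x). Qed.

Lemma unit_injective : injective_space unit_space.
Proof.
move=> A B i _ f; exists (unit_map B).
by rewrite [f]unit_map_uniq; exact: unit_map_uniq.
Qed.

End Terminal.

Section ContMetStructure.
Variable R : realType.

Definition contmet_terminal : terminal_object (ContMet R).
Proof.
exists (exist _ (unit_space R) (@unit_injective R))
  (fun X => unit_map (sval X)).
by move=> X f; exact: unit_map_uniq.
Defined.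

Definition contmet_product (X Y : ContMet R) : binary_product X Y.
Proof.
exists (exist _ (product_space (sval X) (sval Y))
  (product_injective (svalP X) (svalP Y)))
  (product_fst (sval X) (sval Y)) (product_snd (sval X) (sval Y))
  (fun Z f g => product_pair f g).
- by move=> Z f g; exact: contraction_ext.
- by move=> Z f g; exact: contraction_ext.
- by move=> Z h; apply: contraction_ext => z /=; rewrite -surjective_pairing.
Defined.

Definition contmet_exponential (X Y : ContMet R) :
  exponential contmet_product X Y.
Proof.
exists (exist _ (expo_space (sval Y) (svalP X))
  (expo_injective (injX := svalP X) (svalP Y)))
  (expo_ev (sval Y) (svalP X)) (fun W f => expo_curry (svalP X) f).
- by move=> W f; apply: contraction_ext => -[w x].
- by move=> W g; apply: contraction_ext => w; exact: contraction_ext.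
Defined.

End ContMetStructure.

Theorem theorem8p9 (R : realType) : inhabited (cartesian_closed (ContMet R)).
Proof.
split; apply: (CartesianClosed (contmet_terminal R)
  (cc_product := @contmet_product R)).
exact: contmet_exponential.
Qed.
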